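(* Let $\nu\in A_2$, $0<p<\infty$, and let $\mathcal D$ be a dyadic system in $\mathbb R^n$. Then $\mathbf B^p_\nu(\mathbb R^n,\mathcal D)\subset\mathrm{VMO}_\nu(\mathbb R^n,\mathcal D)$.
   Context: $A_2$: weights $w$ with $\sup_Q(\frac1{|Q|}\int_Qw)(\frac1{|Q|}\int_Qw^{-1})<\infty$; $w(E)=\int_Ew$. A dyadic system is any $\mathcal D^\omega=\bigcup_k\{2^{-k}([0,1)^n+m+(-1)^k\omega):m\in\mathbb Z^n\}$, $\omega\in\{0,\frac13,\frac23\}^n$. $\|b\|^p_{\mathbf B^p_\nu(\mathbb R^n,\mathcal D)}:=\sum_{Q\in\mathcal D}\big(\frac1{\nu(Q)}\int_Q|b-\langle b\rangle_Q|\big)^p$, $\langle b\rangle_Q$ the average. $\mathrm{BMO}_\nu(\mathbb R^n,\mathcal D)$ is the set of $b\in L^1_{loc}$ with $\sup_{Q\in\mathcal D}\frac1{\nu(Q)}\int_Q|b-\langle b\rangle_Q|<\infty$, and $\mathrm{VMO}_\nu(\mathbb R^n,\mathcal D)$ the set of such $b$ for which $\frac1{\nu(Q)}\int_Q|b-\langle b\rangle_Q|\to0$ uniformly over $Q\in\mathcal D$ as $\ell(Q)\to0$, as $\ell(Q)\to\infty$, and for $Q\subset\mathbb R^n\setminus B(x_0,a)$ as $a\to\infty$ ($x_0$ a fixed point). *)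

(* Defs.v *)
From HB Require Import structures.
From mathcomp Require Import all_boot all_order all_algebra.
From mathcomp Require Import all_classical all_reals all_analysis.
Import Order.TTheory GRing.Theory Num.Theory.

Set Implicit Arguments.
Unset Strict Implicit.
Unset Printing Implicit Defensive.

Local Open Scope ring_scope.
Local Open Scope classical_set_scope.

(* Product of two sigma-finite measures, packaged as a sigma-finite    *)
(* measure (the library proves this but the instance is not canonical  *)
(* on [product_measure1], so we re-package it under an alias).         *)
Section sf_prod.
Local Open Scope ereal_scope.
Context d1 d2 (T1 : measurableType d1) (T2 : measurableType d2) (R : realType).
Variable m1 : {sigma_finite_measure set T1 -> \bar R}.
Variable m2 : {sigma_finite_measure set T2 -> \bar R}.

Definition sf_prod : set (T1 * T2)%type -> \bar R := (m1 \x m2)%E.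

HB.instance Definition _ := Measure.on sf_prod.

Lemma sf_prod_sigma_finite : sigma_finite setT sf_prod.
Proof.
have /sigma_finiteP[F [TF ndF Foo]] := sigma_finiteT m1.
have /sigma_finiteP[G [TG ndG Goo]] := sigma_finiteT m2.
exists (fun n => F n `*` G n).
 rewrite -setXTT TF TG predeqE => -[x y]; split.
    move=> [/= [n _ Fnx] [k _ Gky]]; exists (maxn n k) => //; split.
    - by move: x Fnx; exact/subsetPset/ndF/leq_maxl.
    - by move: y Gky; exact/subsetPset/ndG/leq_maxr.
  by move=> [n _ []/= ? ?]; split; exists n.
move=> k; have [? ?] := Foo k; have [? ?] := Goo k.
split; first exact: measurableX.
by rewrite /sf_prod product_measure1E// lte_mul_pinfty// ge0_fin_numE.
Qed.

HB.instance Definition _ := Measure_isSigmaFinite.Build _ _ _ sf_prod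
  sf_prod_sigma_finite.
End sf_prod.

Section Rn.
Variable R : realType.

(* R^n is modelled as R * (R * ( ... * unit)), with the Borel sigma-algebra *)
(* of each factor and the product sigma-algebra.                            *)
Fixpoint Rn_disp (n : nat) : measure_display :=
  if n is n'.+1 then (sigma_display (@measurable _ (ocitv_type R)), Rn_disp n').-prod
  else default_measure_display.

Fixpoint Rn (n : nat) : measurableType (Rn_disp n) :=
  match n return measurableType (Rn_disp n) with
  | 0 => unit
  | n'.+1 => (measurableTypeR R * Rn n')%type
  end.

Fixpoint lebn (n : nat) : {sigma_finite_measure set (Rn n) -> \bar R} :=
  match n return {sigma_finite_measure set (Rn n) -> \bar R} with
  | 0 => @dirac _ unit tt R
  | n'.+1 => sf_prod (@lebesgue_measure R) (lebn n')
  end.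

Fixpoint coord (n : nat) : Rn n -> 'I_n -> R :=
  match n return Rn n -> 'I_n -> R with
  | 0 => fun _ _ => 0
  | n'.+1 => fun x i =>
      match unlift ord0 i with
      | None => x.1
      | Some j => coord x.2 j
      end
  end.
End Rn.

Section harmonic.
Variables (R : realType) (n : nat).
Local Notation T := (Rn R n).
Local Notation mu := (lebn R n).

Definition box (r : R) : set T := [set x | forall i, - r <= coord x i <= r].

(* L^1_loc: measurable, integrable on every bounded box (hence on every compact set) *)
Definition locally_integrable (f : T -> R) : Prop :=
  measurable_fun setT f /\
  forall r : R, 0 < r -> mu.-integrable (box r) (EFin \o f).

Definition cube (a : 'I_n -> R) (l : R) : set T :=
  [set x | forall i, a i <= coord x i < a i + l].

Definition avg (f : T -> R) (Q : set T) : R :=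
  (fine (mu Q))^-1 * Rintegral mu Q f.

Definition weight (w : T -> R) : Prop :=
  (forall x, 0 < w x) /\ locally_integrable w.

Definition A2 (w : T -> R) : Prop :=
  weight w /\
  exists C : R, forall (a : 'I_n -> R) (l : R), 0 < l ->
    ((avg w (cube a l))%:E *
     (((fine (mu (cube a l)))^-1)%:E *
       \int[mu]_(x in cube a l) ((w x)^-1)%:E) <= C%:E)%E.

Definition wmeas (w : T -> R) (E : set T) : \bar R :=
  (\int[mu]_(x in E) (w x)%:E)%E.

Definition mo (nu b : T -> R) (Q : set T) : \bar R :=
  ((\int[mu]_(x in Q) (`|b x - avg b Q|)%:E) * (wmeas nu Q)^-1)%E.

Definition dyadic_shift (omega : 'I_n -> R) : Prop :=
  forall i, omega i = 0 \/ omega i = 1/3 \/ omega i = 2/3.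

(* the cube 2^{-k}([0,1)^n + m + (-1)^k omega) *)
Definition dcube (omega : 'I_n -> R) (k : int) (m : 'I_n -> int) : set T :=
  [set x | forall i,
     (2:R) ^ (- k) * ((m i)%:~R + (-1) ^ k * omega i) <= coord x i <
     (2:R) ^ (- k) * ((m i)%:~R + 1 + (-1) ^ k * omega i)].

Definition dyadic_system (omega : 'I_n -> R) : set (set T) :=
  [set Q | exists (k : int) (m : 'I_n -> int), Q = dcube omega k m].

Definition dside (omega : 'I_n -> R) (Q : set T) (l : R) : Prop :=
  exists (k : int) (m : 'I_n -> int), Q = dcube omega k m /\ l = (2:R) ^ (- k).

Definition eball (x0 : 'I_n -> R) (a : R) : set T :=
  [set x | \sum_(i < n) (coord x i - x0 i) ^+ 2 < a ^+ 2].

Definition Besov (p : R) (nu : T -> R) (omega : 'I_n -> R) : set (T -> R) :=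
  [set b | locally_integrable b /\
     (\esum_(Q in dyadic_system omega) poweR (mo nu b Q) p < +oo)%E].

Definition BMO (nu : T -> R) (omega : 'I_n -> R) : set (T -> R) :=
  [set b | locally_integrable b /\
     exists C : R, forall Q, dyadic_system omega Q -> (mo nu b Q <= C%:E)%E].

Definition VMO (nu : T -> R) (omega : 'I_n -> R) : set (T -> R) :=
  [set b | BMO nu omega b /\
    (forall eps : R, 0 < eps -> exists2 delta : R, 0 < delta &
       forall Q l, dyadic_system omega Q -> dside omega Q l -> l < delta ->
         (mo nu b Q < eps%:E)%E) /\
    (forall eps : R, 0 < eps -> exists N : R,
       forall Q l, dyadic_system omega Q -> dside omega Q l -> N < l ->
         (mo nu b Q < eps%:E)%E) /\
    (forall (x0 : 'I_n -> R) (eps : R), 0 < eps -> exists A : R,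
       forall Q a, dyadic_system omega Q -> A < a -> Q `<=` ~` eball x0 a ->
         (mo nu b Q < eps%:E)%E)].

End harmonic.

(* Main.v *)
Require Import Defs.
From HB Require Import structures.
From mathcomp Require Import all_boot all_order all_algebra.
From mathcomp Require Import all_classical all_reals all_analysis.
From mathcomp Require Import finmap ring lra.
Import Order.TTheory GRing.Theory Num.Theory.
Local Open Scope ring_scope.
Local Open Scope classical_set_scope.

(* Since the Besov sum of mo(Q)^p over the dyadic cubes is finite, for every
   eps > 0 only finitely many dyadic cubes have mean oscillation >= eps.  A
   finite family of cubes has side lengths bounded above and away from 0 and
   lies in a bounded region, so every dyadic cube that is small enough, large
   enough or far enough away has mean oscillation < eps; the same finiteness
   gives the BMO bound.  In R^0 all dyadic cubes coincide and have
   every side length 2^-k, so that case is handled separately: there every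
   mean oscillation vanishes. *)

Section esum_finite.
Context {R : realType} {T : choiceType}.
Local Open Scope ereal_scope.

Lemma le_term_esum {D : set T} {a : T -> \bar R} {x : T} :
  D x -> a x <= \esum_(i in D) a i.
Proof.
move=> Dx; apply: esum_ge; exists [set x]; last by rewrite fsbig_set1.
by split; [exact: finite_set1 | move=> y ->].
Qed.

Lemma esum_lty_finite_ge {D : set T} {a : T -> \bar R} {e : R} :
  (0 < e)%R -> \esum_(i in D) a i < +oo ->
  finite_set [set x | D x /\ e%:E <= a x].
Proof.
move=> e_gt0 sum_lty; have [S sum_le] : exists S, \esum_(i in D) a i <= S%:E.
  case: (\esum_(i in D) a i) sum_lty => [r _|//|_]; first by exists r.
  by exists 0%R; rewrite leNye.
(* floor(S/e) + 1 points where a >= e would already sum to more than S *)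
apply: contrapT => /(infinite_set_fset (Num.truncn (S / e)).+1)[B Bge cardB].
have : (#|` B|%:R * e)%:E <= S%:E.
  apply: le_trans sum_le; apply: esum_ge; exists [set` B].
    by split=> // x /Bge[].
  rewrite fsbig_finite //= set_fsetK big_seq.
  apply: le_trans (lee_sum _ (fun i (iB : i \in B) => (Bge i iB).2)).
  by rewrite sumEFin -big_seq big_const_seq count_predT iter_addr_0 mulr_natl.
rewrite lee_fin -ler_pdivlMr // leNgt => /negP; apply.
by apply: lt_le_trans (truncnS_gt _) _; rewrite ler_nat.
Qed.

Lemma esum_poweR_lty_fin_num (D : set T) (a : T -> \bar R) (p : R) x :
  (0 < p)%R -> \esum_(i in D) a i `^ p < +oo -> D x -> 0 <= a x ->
  a x \is a fin_num.
Proof.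
move=> p_gt0 sum_lty Dx ax_ge0; rewrite ge0_fin_numE //.
apply: (lty_poweRy (lt0r_neq0 p_gt0)).
exact: le_lt_trans (le_term_esum (a := fun i => a i `^ p) Dx) sum_lty.
Qed.

Lemma esum_poweR_lty_finite_ge (D : set T) (a : T -> \bar R) (p e : R) :
  (0 < p)%R -> (0 < e)%R -> (forall x, D x -> 0 <= a x) ->
  \esum_(i in D) a i `^ p < +oo -> finite_set [set x | D x /\ e%:E <= a x].
Proof.
move=> p_gt0 e_gt0 a_ge0 sum_lty.
apply: (sub_finite_set _ (esum_lty_finite_ge (powR_gt0 p e_gt0) sum_lty)).
move=> x [Dx ex]; split=> //; rewrite -poweR_EFin.
apply: (gt0_ler_poweR (ltW p_gt0)) => //.
  by rewrite in_itv /= leey lee_fin ltW.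
by rewrite in_itv /= leey a_ge0.
Qed.
End esum_finite.

Lemma filter_forall_finite_set {T : choiceType} {U : Type} {F : set_system U}
    {A : set T} {P : T -> U -> Prop} :
  Filter F -> finite_set A -> (forall x, A x -> \forall u \near F, P x u) ->
  \forall u \near F, forall x, A x -> P x u.
Proof.
move=> FF Afin AP; have : F (\bigcap_(x in [set` fset_set A]) P x).
  by apply: filter_bigI => x; rewrite in_fset_set // => /set_mem; exact: AP.
by rewrite fset_setK //; apply: filterS => u AP' x Ax; exact: AP'.
Qed.

Lemma finite_ge_near_lt {R : realType} {T : choiceType} {U : Type}
    {F : set_system U} {D : set T} {a : T -> \bar R} {e : R}
    {P : T -> U -> Prop} :
  Filter F -> finite_set [set x | D x /\ (e%:E <= a x)%E] ->
  (forall x, D x -> \forall u \near F, ~ P x u) ->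
  \forall u \near F, forall x, D x -> P x u -> (a x < e%:E)%E.
Proof.
move=> FF ge_fin notP.
have := filter_forall_finite_set (P := fun x u => ~ P x u) FF ge_fin
  (fun x xge => notP x xge.1).
apply: filterS => u notPu x Dx Pxu; rewrite ltNge; apply/negP => ex.
exact: notPu x (conj Dx ex) Pxu.
Qed.

Section cubes.
Context {R : realType}.

Lemma coord_surj {n : nat} (f : 'I_n -> R) :
  exists x : Rn R n, Defs.coord x =1 f.
Proof.
elim: n f => [|n IH] f; first by exists tt => -[].
have [y yf] := IH (fun j => f (lift ord0 j)).
by exists (f ord0, y) => i /=; case: unliftP => [j ->|->].
Qed.

Lemma cube_coord_sub {n : nat} {a a' : 'I_n -> R} {l l' : R} :
  0 < l -> cube a l `<=` cube a' l' ->
  forall i t, a i <= t < a i + l -> a' i <= t < a' i + l'.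
Proof.
move=> l_gt0 sub i t ti.
have [x xE] := coord_surj (fun j => if j == i then t else a j).
have /sub/(_ i) : cube a l x.
  by move=> j; rewrite xE; case: eqP => [->//|_]; rewrite lexx ltrDl.
by rewrite xE eqxx.
Qed.

Lemma cube_neq0 {n : nat} {a : 'I_n -> R} {l : R} : 0 < l -> cube a l !=set0.
Proof.
move=> l_gt0; have [x xE] := coord_surj a.
by exists x => i; rewrite xE lexx ltrDl.
Qed.

Lemma co_itv_side_inj {a1 a2 l1 l2 : R} : 0 < l1 -> 0 < l2 ->
  (forall t, a1 <= t < a1 + l1 -> a2 <= t < a2 + l2) ->
  (forall t, a2 <= t < a2 + l2 -> a1 <= t < a1 + l1) -> l1 = l2.
Proof.
move=> l1_gt0 l2_gt0 sub12 sub21.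
have /andP[a21 _] : a2 <= a1 < a2 + l2 by apply: sub12; rewrite lexx ltrDl.
have /andP[a12 _] : a1 <= a2 < a1 + l1 by apply: sub21; rewrite lexx ltrDl.
apply/eqP; rewrite eq_le !leNgt; apply/andP; split; apply/negP => lt.
- have /andP[_] : a2 <= a1 + l2 < a2 + l2.
    by apply: sub12; apply/andP; split; lra.
  lra.
- have /andP[_] : a1 <= a2 + l1 < a1 + l1.
    by apply: sub21; apply/andP; split; lra.
  lra.
Qed.

Lemma cube_side_inj {n : nat} {a a' : 'I_n.+1 -> R} {l l' : R} :
  0 < l -> 0 < l' -> cube a l = cube a' l' -> l = l'.
Proof.
move=> l_gt0 l'_gt0 eq_cube.
apply: (co_itv_side_inj (a1 := a ord0) (a2 := a' ord0) l_gt0 l'_gt0).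
- by apply: (cube_coord_sub l_gt0 _ ord0); rewrite eq_cube.
- by apply: (cube_coord_sub l'_gt0 _ ord0); rewrite eq_cube.
Qed.

Lemma dcube_cube (n : nat) (omega : 'I_n -> R) (k : int) (m : 'I_n -> int) :
  dcube omega k m =
  cube (fun i => (2:R) ^ (- k) * ((m i)%:~R + (-1) ^ k * omega i))
       ((2:R) ^ (- k)).
Proof.
apply/eq_set => x; apply/eq_forall => i.
by congr (_ <= _ < _); ring.
Qed.

Lemma dside_uniq {n : nat} {omega : 'I_n.+1 -> R} {Q : set (Rn R n.+1)}
    {l l' : R} :
  dside omega Q l -> dside omega Q l' -> l = l'.
Proof.
move=> [k [m [-> ->]]] [k' [m' [eq_Q ->]]].
by move: eq_Q; rewrite !dcube_cube; apply: cube_side_inj; exact: exprz_gt0.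
Qed.

Lemma dyadic_system_neq0 {n : nat} {omega : 'I_n -> R} {Q : set (Rn R n)} :
  dyadic_system omega Q -> Q !=set0.
Proof.
by case=> k [m ->]; rewrite dcube_cube; apply: cube_neq0; exact: exprz_gt0.
Qed.
End cubes.

Lemma eball_near_pinfty {R : realType} {n : nat} (x0 : 'I_n -> R) (x : Rn R n) :
  \forall M \near +oo, forall r, M < r -> eball x0 r x.
Proof.
set s := \sum_(i < n) (Defs.coord x i - x0 i) ^+ 2.
have s_ge0 : 0 <= s by apply: sumr_ge0 => i _; exact: sqr_ge0.
have := nbhs_pinfty_ge (num_real (s + 1)).
by apply: filterS => M sM r Mr; rewrite /eball /= -/s; nra.
Qed.

Lemma mo_ge0 {R : realType} {n : nat} (nu b : Rn R n -> R) (Q : set (Rn R n)) :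
  (forall x, 0 <= nu x) -> (0 <= mo nu b Q)%E.
Proof.
move=> nu_ge0; apply: mule_ge0.
  by apply: integral_ge0 => x _; rewrite lee_fin.
by rewrite inve_ge0; apply: integral_ge0 => x _; rewrite lee_fin.
Qed.

Lemma mo_Rn0 (R : realType) (nu b : Rn R 0 -> R) (Q : set (Rn R 0)) :
  mo nu b Q = 0%E.
Proof.
rewrite /mo /avg /= integral_dirac //= diracE.
have [tQ|] := boolP (tt \in Q); last by rewrite !mul0e.
rewrite /Rintegral integral_dirac //= indicE tQ invr1 !mul1r.
by rewrite subrr normr0 mule0 mul0e.
Qed.

Lemma VMO_Rn0 (R : realType) (nu b : Rn R 0 -> R) (omega : 'I_0 -> R) :
  Defs.locally_integrable b -> VMO nu omega b.
Proof.
move=> b_loc; split; first by split=> //; exists 0 => Q _; rewrite mo_Rn0.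
split=> [e e_gt0|]; first by exists 1 => // Q l _ _ _; rewrite mo_Rn0 lte_fin.
by split=> [e e_gt0|x0 e e_gt0]; exists 0 => Q l _ _ _; rewrite mo_Rn0 lte_fin.
Qed.

Section dyadic_vanishing.
Variables (R : realType) (n : nat) (omega : 'I_n.+1 -> R).
Variable a : set (Rn R n.+1) -> \bar R.
Local Notation D := (dyadic_system omega).
Hypothesis a_fin : forall {Q}, D Q -> a Q \is a fin_num.
Hypothesis a_ge_finite :
  forall {e}, 0 < e -> finite_set [set Q | D Q /\ (e%:E <= a Q)%E].

Lemma dyadic_bounded : exists C, forall Q, D Q -> (a Q <= C%:E)%E.
Proof.
have /filter_ex[M aM] : \forall M \near +oo,
    forall Q, D Q -> (M%:E <= a Q)%E -> (a Q < 1%:E)%E.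
  apply: (finite_ge_near_lt _ (a_ge_finite ltr01)) => Q DQ.
  have := nbhs_pinfty_gt (num_real (fine (a Q))).
  by apply: filterS => M aQM; rewrite -(fineK (a_fin DQ)) lee_fin leNgt aQM.
exists (Num.max M 1) => Q DQ; have [/(aM Q DQ)|] := leP (M%:E) (a Q) => /ltW aQ.
- by apply: le_trans aQ _; rewrite lee_fin le_max lexx orbT.
- by apply: le_trans aQ _; rewrite lee_fin le_max lexx.
Qed.

Lemma dyadic_vanish_small (e : R) : 0 < e -> exists2 delta : R, 0 < delta &
  forall Q l, D Q -> dside omega Q l -> l < delta -> (a Q < e%:E)%E.
Proof.
move=> e_gt0.
have : \forall delta \near 0^'+, forall Q, D Q ->
    (exists2 l, dside omega Q l & l < delta) -> (a Q < e%:E)%E.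
  apply: (finite_ge_near_lt _ (a_ge_finite e_gt0)) => Q [k [m eQ]].
  have dQ : dside omega Q (2 ^ (- k)) by exists k, m.
  have side_gt0 : 0 < (2:R) ^ (- k) by exact: exprz_gt0.
  have := nbhs_right_le side_gt0.
  apply: filterS => delta le_delta [l /(dside_uniq dQ) <-].
  by rewrite ltNge le_delta.
move=> /(filterI (nbhs_right_gt 0))/filter_ex[delta [delta_gt0 aQ]].
by exists delta => // Q l DQ dQ l_lt; apply: aQ DQ _; exists l.
Qed.

Lemma dyadic_vanish_large (e : R) : 0 < e -> exists N : R,
  forall Q l, D Q -> dside omega Q l -> N < l -> (a Q < e%:E)%E.
Proof.
move=> e_gt0.
have /filter_ex[N aQ] : \forall N \near +oo, forall Q, D Q ->
    (exists2 l, dside omega Q l & N < l) -> (a Q < e%:E)%E.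
  apply: (finite_ge_near_lt _ (a_ge_finite e_gt0)) => Q [k [m eQ]].
  have dQ : dside omega Q (2 ^ (- k)) by exists k, m.
  have := nbhs_pinfty_ge (num_real ((2:R) ^ (- k))).
  by apply: filterS => N ge_N [l /(dside_uniq dQ) <-]; rewrite ltNge ge_N.
by exists N => Q l DQ dQ N_lt; apply: aQ DQ _; exists l.
Qed.

Lemma dyadic_vanish_far (x0 : 'I_n.+1 -> R) (e : R) : 0 < e -> exists A : R,
  forall Q r, D Q -> A < r -> Q `<=` ~` eball x0 r -> (a Q < e%:E)%E.
Proof.
move=> e_gt0.
have /filter_ex[A aQ] : \forall A \near +oo, forall Q, D Q ->
    (exists2 r, A < r & Q `<=` ~` eball x0 r) -> (a Q < e%:E)%E.
  apply: (finite_ge_near_lt _ (a_ge_finite e_gt0)).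
  move=> Q /dyadic_system_neq0[x Qx].
  have := eball_near_pinfty x0 x.
  by apply: filterS => A xin [r /xin x_r /(_ x Qx)].
by exists A => Q r DQ A_lt Q_far; apply: aQ DQ _; exists r.
Qed.
End dyadic_vanishing.

Lemma VMO_of_finite_mo_ge (R : realType) (n : nat) (nu b : Rn R n.+1 -> R)
    (omega : 'I_n.+1 -> R) :
  Defs.locally_integrable b ->
  (forall Q, dyadic_system omega Q -> mo nu b Q \is a fin_num) ->
  (forall e, 0 < e ->
    finite_set [set Q | dyadic_system omega Q /\ (e%:E <= mo nu b Q)%E]) ->
  VMO nu omega b.
Proof.
move=> b_loc mo_fin mo_ge_finite.
split; first by split=> //; exact: dyadic_bounded.
split; first exact: dyadic_vanish_small.
by split; [exact: dyadic_vanish_large | exact: dyadic_vanish_far].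
Qed.

Theorem lemma3p5 (R : realType) (n : nat) (nu : Rn R n -> R) (p : R)
    (omega : 'I_n -> R) :
  A2 nu -> 0 < p -> dyadic_shift omega ->
  Besov p nu omega `<=` VMO nu omega.
Proof.
move=> [[nu_gt0 _] _] p_gt0 _ b [b_loc sum_lty].
case: n => [|n] in nu omega nu_gt0 b b_loc sum_lty *; first exact: VMO_Rn0.
have mo_ge0 Q : (0 <= mo nu b Q)%E by apply: mo_ge0 => x; exact: ltW.
apply: VMO_of_finite_mo_ge => // [Q DQ|e e_gt0].
- exact: esum_poweR_lty_fin_num p_gt0 sum_lty DQ (mo_ge0 Q).
- exact: esum_poweR_lty_finite_ge p_gt0 e_gt0 (fun Q _ => mo_ge0 Q) sum_lty.
Qed.
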